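(* Assume the reference distribution $P_0$ is regular. For any given target $\tau$, there exists a threshold $\underline v_{RS}\in[p_{RS}^{PP},1]$ such that, for a buyer with valuation $v\in[0,1]$, $$q_{RS}^*(v)v-m_{RS}^*(v)\ \ge\ q_{RS}^{PP}(v)v-m_{RS}^{PP}(v)\quad\text{if and only if}\quad v\le\underline v_{RS}.$$ Furthermore, for a power reference distribution ($P_0(x)=x^\alpha$ on $[0,1]$ for some $\alpha\ge1$), the inequality $q_{RS}^*(v)v-m_{RS}^*(v)\ge q_{RS}^{PP}(v)v-m_{RS}^{PP}(v)$ holds for all $v\in[0,1]$.
   Context: $P_0$ is a continuous probability distribution supported on $[0,1]$ with density $p_0$ and complementary CDF $\bar P_0=1-P_0$. It is regular if $x-\frac{1-P_0(x)}{p_0(x)}$ is strictly increasing in $x$. $\mathcal R_{P_0}(x)=x\bar P_0(x)$, $\Pi_0=\max_{x\in[0,1]}\mathcal R_{P_0}(x)$, and the target satisfies $0<\tau<\Pi_0$. For regular $P_0$ and $\pi\in(0,\Pi_0)$, $u(\pi)<w(\pi)$ denote the two solutions of $\mathcal R_{P_0}(x)=\pi$. Optimal robust satisficing (RS) mechanism: for $k>0$ let $\rho^*(k)=\min_{\pi\in[0,\Pi_0]}\{\pi+k\int_0^1(\bar P_0(x)-\pi/x)^+\mathrm dx\}$, with minimizer $\pi^*(k)$ (the solution of $\ln\frac{w(\pi)}{u(\pi)}=\frac1k$). Let $k_{RS}^*=(\rho^* )^{-1}(\tau)$, $u^*=u(\pi^*(k_{RS}^* ))$, $w^*=w(\pi^*(k_{RS}^*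 ))$. Then $(q_{RS}^*(v),m_{RS}^*(v))=(0,0)$ for $v<u^*$, $=k_{RS}^*(\ln(v/u^* ),\,v-u^* )$ for $v\in[u^*,w^* )$, and $=(1,\,k_{RS}^*(w^*-u^* ))$ for $v\in[w^*,1]$. Optimal RS posted-price (PP) mechanism: with $\rho^{PP}(p,k)=\mathbb E_{P_0}[\min\{p,k(\tilde v-p)^+\}]$, $p^{PP*}(k)=\arg\max_{p\in[0,1]}\rho^{PP}(p,k)$, $\rho^{PP*}(k)=\max_{p\in[0,1]}\rho^{PP}(p,k)$, set $k_{RS}^{PP}=(\rho^{PP*})^{-1}(\tau)$, $p_{RS}^{PP}=p^{PP*}(k_{RS}^{PP})$, $q_{RS}^{PP}(v)=\mathbf 1(v\ge p_{RS}^{PP})$, $m_{RS}^{PP}(v)=p_{RS}^{PP}\mathbf 1(v\ge p_{RS}^{PP})$. Here $y^+=\max\{y,0\}$. *)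

(* Defs.v *)
From HB Require Import structures.
From mathcomp Require Import all_boot all_order all_algebra.
From mathcomp Require Import all_classical all_reals all_analysis.

Set Implicit Arguments.
Unset Strict Implicit.
Unset Printing Implicit Defensive.

Import Order.TTheory GRing.Theory Num.Theory.
Import numFieldNormedType.Exports.

Local Open Scope classical_set_scope.
Local Open Scope ring_scope.

Definition pos_part (R : realType) (y : R) : R := Num.max y 0.

(* [xget 0 A] is an element of A when A is non-empty (and 0 otherwise); below
   it is used for arg min, arg max and inverse images. *)
Definition argmin (R : realType) (D : set R) (f : R -> R) : R :=
  xget 0 [set x | D x /\ forall y, D y -> f x <= f y].

Definition argmax (R : realType) (D : set R) (f : R -> R) : R :=
  xget 0 [set x | D x /\ forall y, D y -> f y <= f x].

(* The preimage of t under f among the k > 0. *)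
Definition inv_pos (R : realType) (f : R -> R) (t : R) : R :=
  xget 0 [set k | 0 < k /\ f k = t].

Section reference_distribution.
Context (R : realType) (P0 : probability (measurableTypeR R) R).

(* P0 is carried by [0,1] and has density p0 with respect to the Lebesgue
   measure. *)
Definition continuous_on_unit (p0 : R -> R) : Prop :=
  [/\ P0 `[0, 1]%classic = 1%E,
      measurable_fun [set: measurableTypeR R] p0,
      forall x, 0 <= p0 x
    & forall A : set (measurableTypeR R), measurable A ->
        P0 A = (\int[lebesgue_measure]_(x in A) (p0 x)%:E)%E].

Definition cdf0 (x : R) : R := fine (P0 `]-oo, x]%classic).

Definition ccdf0 (x : R) : R := 1 - cdf0 x.

Definition virtual_value (p0 : R -> R) (x : R) : R := x - ccdf0 x / p0 x.

(* Monotonicity is required on the open interval only: the density may vanish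
   or be infinite at the end points (e.g. a x^(a-1) at 0).  Positivity of p0
   says that the quotient is a genuine one, since y / 0 = 0 in MathComp. *)
Definition regular (p0 : R -> R) : Prop :=
  (forall x, 0 < x < 1 -> 0 < p0 x) /\
  (forall x y, 0 < x -> x < y -> y < 1 ->
    virtual_value p0 x < virtual_value p0 y).

Definition revenue (x : R) : R := x * ccdf0 x.

(* When P0 has a density on [0,1] as above, the infima and suprema below
   (for 0 < k and, for u_sol and w_sol, 0 <= pi <= Pi0) are minima and maxima. *)
Definition Pi0 : R := sup [set revenue x | x in `[0, 1]].

(* The smaller and the larger of the two solutions of [revenue x = pi]. *)
Definition u_sol (pi : R) : R := inf [set x | 0 <= x <= 1 /\ revenue x = pi].
Definition w_sol (pi : R) : R := sup [set x | 0 <= x <= 1 /\ revenue x = pi].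

(* At x = 0 the integrand takes a junk value (pi / 0 = 0), on a null set. *)
Definition RS_obj (k pi : R) : R :=
  pi + k * \int[lebesgue_measure]_(x in `[0, 1]) pos_part (ccdf0 x - pi / x).

Definition rho_RS (k : R) : R := inf [set RS_obj k pi | pi in `[0, Pi0]].
Definition pi_RS (k : R) : R := argmin `[0, Pi0]%classic (RS_obj k).

Definition PP_obj (k p : R) : R :=
  fine 'E_P0[fun v : R => Num.min p (k * pos_part (v - p))].

Definition rho_PP (k : R) : R := sup [set PP_obj k p | p in `[0, 1]].
Definition price_PP (k : R) : R := argmax `[0, 1]%classic (PP_obj k).

Section mechanisms.
Variable tau : R.

Definition k_RS : R := inv_pos rho_RS tau.
Definition u_RS : R := u_sol (pi_RS k_RS).
Definition w_RS : R := w_sol (pi_RS k_RS).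

Definition q_RS (v : R) : R :=
  if v < u_RS then 0 else if v < w_RS then k_RS * ln (v / u_RS) else 1.

Definition m_RS (v : R) : R :=
  if v < u_RS then 0 else
  if v < w_RS then k_RS * (v - u_RS) else k_RS * (w_RS - u_RS).

Definition k_PP : R := inv_pos rho_PP tau.
Definition p_PP : R := price_PP k_PP.

Definition q_PP (v : R) : R := if p_PP <= v then 1 else 0.
Definition m_PP (v : R) : R := if p_PP <= v then p_PP else 0.

End mechanisms.
End reference_distribution.

(* Main.v *)
Require Import Defs.
From mathcomp Require Import all_boot all_order all_algebra.
From mathcomp Require Import all_classical all_reals all_analysis.
From mathcomp Require Import measurable_realfun ring lra.
Set Implicit Arguments.
Unset Strict Implicit.
Unset Printing Implicit Defensive.
Import Order.TTheory GRing.Theory Num.Theory.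
Import numFieldNormedType.Exports.
Local Open Scope classical_set_scope.
Local Open Scope ring_scope.

(** The surplus U of a buyer of valuation v under the screening mechanism
    starts at 0 and has slope q_RS(v), which lies in [0,1]; under a posted price
    p it is 0 up to p and has slope one afterwards.  Hence the screening
    mechanism is weakly better below p, and above p its advantage is continuous
    and nonincreasing in v: the valuations that weakly prefer it form an initial
    segment ([utility_threshold]), which is the whole of [0,1] as soon as the
    valuation 1 belongs to it, that is, as soon as the largest screening payment
    k (w - u) does not exceed p ([utility_RS_dominates]).  All this rests on the
    identity k ln (w / u) = 1, which makes U continuous and its slope at most
    one.

    That identity is the first-order condition of the minimisation over pi.
    Write G for the complementary distribution function and r(x) = x G(x) for
    the revenue, which is unimodal.  Given k, let u < w be valuations of ratio
    e^(1/k) with r(u) = r(w); they exist by the intermediate value theorem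
    ([level_pair_ratio]).  For every pi >= 0, bounding (G(x) - pi / x)^+ from
    below by G(x) - pi / x on ]u, w] and by 0 elsewhere shows that the objective
    is at least k times the integral of G over ]u, w], with equality for
    pi = r(u) only ([shortfall_integral_level], [shortfall_integral_gt]).  So
    the unique minimiser is r(u), and the optimal value is that multiple of the
    integral.  Being 1-Lipschitz in k, the optimal value reaches every target
    strictly between 0 and the monopoly revenue ([rho_RS_surjective]).

    Unimodality follows from regularity because
    r(y) - r(x) is the integral over ]x, y] of G(t) - t p0(t), which is minus
    the density times the virtual value, and the virtual value changes sign at
    most once ([revenueB], [regular_unimodal]).

    Posted prices obey the same pattern: with t = 1 + 1/k the objective is k
    times the integral of G over ]p, t p], whose derivative in p has the sign of
    r(t p) - r(p).  It is therefore maximal exactly at the lower member of the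
    pair of equal revenues and ratio t ([PP_objE], [gain_lt]).

    For P0(x) = x^alpha, the function (alpha x + r(x)) / (alpha + 1) is a
    primitive of G, so the integral of G over ]u, w] equals
    alpha / (alpha + 1) (w - u) whenever r(u) = r(w).  Equating both optimal
    values to tau gives k (w - u) = (alpha + 1) / alpha tau = p: the valuation 1
    is indifferent between the two mechanisms ([payment_RS_pow],
    [p_PP_pow]). *)

(** * Integrals on real intervals *)

Section integral.
Context {R : realType}.
Local Notation mu := (@lebesgue_measure R).
Local Notation integrable D f := (mu.-integrable D (EFin \o f)).
Implicit Types (D : set (measurableTypeR R)) (f g : R -> R).

Lemma integrable_EFinD D f g : measurable D ->
  integrable D f -> integrable D g -> integrable D (fun x => f x + g x).
Proof. by move=> mD mf mg; exact: (integrableD mD mf mg). Qed.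

Lemma integrable_EFinB D f g : measurable D ->
  integrable D f -> integrable D g -> integrable D (fun x => f x - g x).
Proof. by move=> mD mf mg; exact: (integrableB mD mf mg). Qed.

Lemma integrable_EFinZl D f c : measurable D ->
  integrable D f -> integrable D (fun x => c * f x).
Proof. by move=> mD mf; exact: (integrableZl mD c mf). Qed.

Lemma continuous_integrable_itv (a b : R) (c d : bool) f : continuous f ->
  integrable [set` Interval (BSide c a) (BSide d b)] f.
Proof.
move=> cf.
have /integrableS : integrable `[a, b]%classic f.
  apply: continuous_compact_integrable; first exact: segment_compact.
  exact: continuous_subspaceT.
apply=> //; by apply: subset_itvScc; rewrite bnd_simp; case: c; case: d.
Qed.

Lemma Rintegral_cst_itv (a b c : R) (d e : bool) : a <= b ->
  \int[mu]_(x in [set` Interval (BSide d a) (BSide e b)]) c = c * (b - a).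
Proof.
move=> ab; rewrite Rintegral_cst//= lebesgue_measure_itv/= lte_fin.
case: ltgtP ab => [//|//|-> _] /=; by rewrite subrr.
Qed.

Lemma Rintegral_itv_split (a b c : R) f : a <= b -> b <= c ->
  integrable `]a, c] f ->
  \int[mu]_(x in `]a, c]) f x =
  \int[mu]_(x in `]a, b]) f x + \int[mu]_(x in `]b, c]) f x.
Proof.
move=> ab bc intf; rewrite -Rintegral_setU//=.
- by rewrite -itv_bndbnd_setU// bnd_simp.
- by rewrite -itv_bndbnd_setU ?bnd_simp.
- apply/disj_setPS => x /= []; rewrite !in_itv/= => /andP[_ xb] /andP[bx _].
  by move: (lt_le_trans bx xb); rewrite ltxx.
Qed.

(** If the integral were zero, the nonnegative function would vanish almost
    everywhere, hence on an interval of positive length. *)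
Lemma Rintegral_gt0 (D : set (measurableTypeR R)) (f : R -> R) (a b : R) :
  measurable D -> mu.-integrable D (EFin \o f) -> a < b ->
  `]a, b[%classic `<=` D -> (forall x, D x -> 0 <= f x) ->
  (forall x, a < x < b -> 0 < f x) -> 0 < \int[mu]_(x in D) f x.
Proof.
move=> mD intf ab abD f0 fab; rewrite lt_neqAle Rintegral_ge0// andbT.
apply/negP => /eqP f00.
have if0 : (\int[mu]_(x in D) `|(EFin \o f) x|)%E = 0%E.
  rewrite -[RHS]/(0%:E) [in RHS]f00 fineK; last exact: integrable_fin_num.
  by apply: eq_integral => x /set_mem Dx /=; rewrite ger0_norm ?f0.
have mf : measurable_fun D (EFin \o f) by case/integrableP : intf.
have [N [mN N0 DN]] := iffLR (ae_eq_integral_abs mu mD mf) if0.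
suff abN : `]a, b[%classic `<=` N.
  have : (mu `]a, b[%classic <= mu N)%E by apply: le_measure; rewrite ?inE.
  rewrite N0 lebesgue_measure_itv/= lte_fin ab -EFinB lee_fin.
  by rewrite leNgt subr_gt0 ab.
move=> x abx; apply: DN => /= /(_ (abD _ abx))[fx0].
by move: abx (fab x); rewrite /= in_itv/= => -> /(_ isT); rewrite fx0 ltxx.
Qed.

Lemma lt_Rintegral (D : set (measurableTypeR R)) (f g : R -> R) (a b : R) :
  measurable D -> mu.-integrable D (EFin \o f) -> mu.-integrable D (EFin \o g) ->
  a < b -> `]a, b[%classic `<=` D -> (forall x, D x -> f x <= g x) ->
  (forall x, a < x < b -> f x < g x) ->
  \int[mu]_(x in D) f x < \int[mu]_(x in D) g x.
Proof.
move=> mD intf intg ab abD fg fgab; rewrite -subr_gt0 -RintegralB//.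
apply: (@Rintegral_gt0 _ _ a b) => //.
- exact: integrable_EFinB.
- by move=> x Dx; rewrite subr_ge0 fg.
- by move=> x abx; rewrite subr_gt0 fgab.
Qed.

Lemma integrable_in_continuous_itv (a b : R) (c d : bool) (f : R -> R) :
  (forall x, a <= x <= b -> {for x, continuous f}) ->
  mu.-integrable [set` Interval (BSide c a) (BSide d b)] (EFin \o f).
Proof.
move=> cf.
have : mu.-integrable `[a, b] (EFin \o f).
  apply: continuous_compact_integrable; first exact: segment_compact.
  by apply: continuous_in_subspaceT => x /set_mem/=; rewrite in_itv/=; exact: cf.
move=> /integrableS; apply=> //.
by apply: subset_itvScc; rewrite bnd_simp; case: c; case: d.
Qed.

Lemma Rintegral_FTC2 (f F : R -> R) (a b : R) : a < b ->
  (forall x, a <= x <= b -> {for x, continuous f}) ->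
  (forall x, a <= x <= b -> is_derive x 1 F (f x)) ->
  \int[mu]_(x in `]a, b]) f x = F b - F a.
Proof.
move=> ab cf dF; rewrite Rintegral_itv_obnd_cbnd;
  last exact: integrable_in_continuous_itv.
have dF' x : a <= x <= b -> derivable F x 1 by move=> /dF[].
have cF x : a <= x <= b -> {for x, continuous F}.
  by move=> /dF' h; apply: differentiable_continuous; exact/derivable1_diffP.
rewrite /Rintegral (@continuous_FTC2 _ f F) //.
- apply: continuous_in_subspaceT => x /set_mem/=; rewrite in_itv/=; exact: cf.
- split.
  + by move=> x; rewrite in_itv/= => /andP[ax xb]; apply: dF'; rewrite !ltW.
  + by apply: cvg_at_right_filter; apply: cF; rewrite lexx ltW.
  + by apply: cvg_at_left_filter; apply: cF; rewrite lexx ltW.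
- move=> x; rewrite in_itv/= => /andP[ax xb]; rewrite derive1E.
  by have [|_ ->] := dF x; rewrite ?ltW.
Qed.

Lemma Rintegral_inv (a b : R) : 0 < a -> a < b ->
  \int[mu]_(x in `]a, b]) x^-1 = ln (b / a).
Proof.
move=> a0 ab; have x_gt0 x : a <= x <= b -> 0 < x.
  by move=> /andP[ax _]; exact: lt_le_trans ax.
have dln x : a <= x <= b -> is_derive x 1 (@ln R) x^-1.
  by move=> /x_gt0; exact: is_derive1_ln.
rewrite (Rintegral_FTC2 ab _ dln); last first.
  by move=> x /x_gt0 x0; apply: inv_continuous; rewrite gt_eqF.
by rewrite ln_div// posrE// (lt_trans a0).
Qed.

End integral.

(** * The distribution function of a density on the unit interval *)

Section distribution.
Context {R : realType} {P0 : probability (measurableTypeR R) R} {p0 : R -> R}.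
Context (hP0 : continuous_on_unit P0 p0).
Local Notation mu := (@lebesgue_measure R).
Local Notation G := (ccdf0 P0).
Local Notation F := (cdf0 P0).
Local Notation r := (revenue P0).

Lemma density_integrable (A : set (measurableTypeR R)) : measurable A ->
  mu.-integrable A (EFin \o p0).
Proof.
case: hP0 => _ mp p_ge0 dP mA.
apply: (@integrableS _ _ _ _ setT) => //.
apply/integrableP; split; first exact/measurable_EFinP.
under eq_integral do rewrite /= ger0_norm//.
by rewrite -dP// probability_setT ltry.
Qed.

Lemma cdf0B (x y : R) : x <= y -> F y - F x = \int[mu]_(t in `]x, y]) p0 t.
Proof.
case: hP0 => _ mp p_ge0 dP xy.
have dj : P0 `]-oo, y]%classic = (P0 `]-oo, x]%classic + P0 `]x, y]%classic)%E.
  rewrite -measureU//.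
    by rewrite -itv_bndbnd_setU// bnd_simp.
  apply/seteqP; split => // z /=; rewrite !in_itv/= => -[zx /andP[xz _]].
  by move: (lt_le_trans xz zx); rewrite ltxx.
rewrite /cdf0 dj fineD ?fin_num_measure// addrAC subrr add0r.
by rewrite dP.
Qed.

Lemma cdf0_le (x y : R) : x <= y -> F x <= F y.
Proof.
move=> xy; rewrite -subr_ge0 cdf0B//; apply: Rintegral_ge0 => z _.
by case: hP0.
Qed.

Lemma cdf0_ge0 (x : R) : 0 <= F x.
Proof. exact: fine_ge0. Qed.

Lemma cdf0_le1 (x : R) : F x <= 1.
Proof. by rewrite -lee_fin fineK ?fin_num_measure// probability_le1. Qed.

Lemma cdf0_1 : F 1 = 1.
Proof.
apply/eqP; rewrite eq_le cdf0_le1/=.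
rewrite -lee_fin fineK ?fin_num_measure//.
case: hP0 => <- _ _ _; apply: le_measure; rewrite ?inE//.
by apply: subset_itvr.
Qed.

(** The distribution function is locally an indefinite integral of the density;
    in particular there are no atoms. *)
Lemma cdf0_continuous : continuous F.
Proof.
move=> x.
have ab : x - 1 < x + 1 by lra.
pose I y := parameterized_integral mu (x - 1) y p0.
have FI y : x - 1 <= y -> F y = F (x - 1) + I y.
  move=> ay; rewrite -[LHS](subrKC (F (x - 1))) cdf0B// /I.
  by rewrite Rintegral_itv_obnd_cbnd//; exact: density_integrable.
have /(continuous_within_itvP _ ab)[cI _ _] := parameterized_integral_continuous
  (ltW ab) (density_integrable (measurable_itv `[x - 1, x + 1])).
have cx : {for x, continuous (fun y => F (x - 1) + I y)}.
  apply: continuousD; first exact: cst_continuous.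
  by apply: cI; rewrite in_itv/=; apply/andP; split; lra.
rewrite /continuous_at FI; last by lra.
apply: cvg_trans cx; apply: near_eq_cvg; near=> y; rewrite (FI y)//.
by apply/ltW; near: y; apply: lt_nbhsr; lra.
Unshelve. all: by end_near. Qed.

Lemma ccdf0_continuous : continuous G.
Proof.
move=> x; apply: continuousB; [exact: cst_continuous|exact: cdf0_continuous].
Qed.

Lemma revenue_continuous : continuous r.
Proof.
by move=> x; apply: continuousM; [exact: cvg_id|exact: ccdf0_continuous].
Qed.

Lemma ccdf0_ge0 x : 0 <= G x.
Proof. by rewrite subr_ge0 cdf0_le1. Qed.

Lemma ccdf0_le1 x : G x <= 1.
Proof. by rewrite gerBl cdf0_ge0. Qed.

Lemma ccdf0_eq0 x : 1 <= x -> G x = 0.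
Proof.
move=> x1; apply/eqP; rewrite eq_le ccdf0_ge0 andbT.
by rewrite subr_le0 -cdf0_1 cdf0_le.
Qed.

Lemma ccdf0_le x y : x <= y -> G y <= G x.
Proof. by move=> xy; rewrite lerD2l lerN2 cdf0_le. Qed.

End distribution.

(** * Regularity makes revenue unimodal *)

(** Strict monotonicity on either side of the mode, rather than uniqueness of
    the maximiser, is what makes every revenue level strictly between 0 and the
    maximum be reached exactly twice. *)
Definition unimodal {R : realType} (P0 : probability (measurableTypeR R) R)
    (xs : R) : Prop :=
  [/\ 0 < xs < 1,
      forall x y, 0 <= x -> x < y -> y <= xs -> revenue P0 x < revenue P0 y
    & forall x y, xs <= x -> x < y -> y <= 1 -> revenue P0 y < revenue P0 x].

Section regularity.
Context {R : realType} {P0 : probability (measurableTypeR R) R} {p0 : R -> R}.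
Context (hP0 : continuous_on_unit P0 p0).
Local Notation mu := (@lebesgue_measure R).
Local Notation G := (ccdf0 P0).
Local Notation F := (cdf0 P0).
Local Notation r := (revenue P0).

(* Formally the derivative of the revenue. *)
Let dr (t : R) := G t - t * p0 t.

Lemma marginal_revenue_integrable x y :
  mu.-integrable `]x, y] (EFin \o dr).
Proof.
have iG : mu.-integrable `]x, y] (EFin \o G).
  exact/continuous_integrable_itv/(ccdf0_continuous hP0).
have ip : mu.-integrable `]x, y] (EFin \o (fun t => (`|x| + `|y|) * p0 t)).
  by apply: integrable_EFinZl => //; exact: (density_integrable hP0).
apply: integrable_EFinB => //; apply: le_integrable ip => //.
- apply/measurable_EFinP; apply: measurable_funM; first exact: measurable_id.
  by case: hP0 => _ mp _ _; exact: measurable_funTS.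
- move=> t /=; rewrite in_itv/= => /andP[xt ty]; rewrite lee_fin !normrM.
  apply: ler_wpM2r => //; rewrite [leRHS]ger0_norm ?addr_ge0//.
  rewrite ler_norml; have := ler_norm y; have := ler_norm (- x).
  have := normr_ge0 x; have := normr_ge0 y; rewrite normrN.
  by move=> *; apply/andP; split; lra.
Qed.

(** The density need not be continuous, so the revenue need not be
    differentiable, and the product rule is proved by refinement.  On one
    interval, r(y) - r(x) is the integral of G(y) - x p0(t), and this integrand
    differs from G(t) - t p0(t) by at most F(y) - F(x) in one direction and by
    (y - x) p0(t) in the other; the integrated error (y - x) (F(y) - F(x)) is
    halved each time all intervals are cut at their midpoints. *)
Lemma marginal_revenue_error x y n : 0 <= x -> x <= y ->
  `|r y - r x - \int[mu]_(t in `]x, y]) dr t| <= (y - x) / 2 ^+ n * (F y - F x).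
Proof.
elim: n x y => [|n IH] x y x0 xy; last first.
  pose m := (x + y) / 2.
  have xm : x <= m by rewrite /m; lra.
  have my : m <= y by rewrite /m; lra.
  have := IH _ _ x0 xm; have := IH _ _ (le_trans x0 xm) my.
  rewrite (Rintegral_itv_split xm my (marginal_revenue_integrable _ _)).
  move=> h1 h2.
  rewrite (_ : _ - _ = (r y - r m - \int[mu]_(t in `]m, y]) dr t) +
    (r m - r x - \int[mu]_(t in `]x, m]) dr t)); last by ring.
  apply: (le_trans (ler_normD _ _)); apply: (le_trans (lerD h1 h2)).
  rewrite exprS invfM /m; set c := (2 ^+ n)^-1; lra.
have ip : mu.-integrable `]x, y] (EFin \o p0) by exact: (density_integrable hP0).
have ic c : mu.-integrable `]x, y] (EFin \o cst c).
  by apply: continuous_integrable_itv => z; exact: cst_continuous.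
have intc (c d : R) : mu.-integrable `]x, y] (EFin \o (fun t => c + d * p0 t)).
  exact: (integrable_EFinD _ (ic c) (integrable_EFinZl d _ ip)).
have IE (c d : R) :
    \int[mu]_(t in `]x, y]) (c + d * p0 t) = c * (y - x) + d * (F y - F x).
  rewrite (RintegralD _ (ic c) (integrable_EFinZl d _ ip))//.
  by rewrite Rintegral_cst_itv// RintegralZl// -(cdf0B hP0).
have rE : r y - r x = \int[mu]_(t in `]x, y]) (G y + - x * p0 t).
  by rewrite IE /revenue /ccdf0; lra.
have p_ge0 t : 0 <= p0 t by case: hP0.
have idr := marginal_revenue_integrable x y.
have Gle t : t \in `]x, y] -> G y <= G t <= G x.
  rewrite in_itv/= => /andP[xt ty].
  by rewrite !(ccdf0_le hP0)// ltW.
rewrite expr0 divr1 ler_norml rE -RintegralB//; apply/andP; split.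
  apply: (@le_trans _ _ (\int[mu]_(t in `]x, y]) (- (F y - F x) + 0 * p0 t))).
    by rewrite IE; lra.
  apply: le_Rintegral => //; first exact: integrable_EFinB.
  move=> t /[dup]/Gle/andP[Gt1 Gt2]/=; rewrite in_itv/= => /andP[xt ty].
  have : 0 <= (t - x) * p0 t by rewrite mulr_ge0// subr_ge0 ltW.
  by rewrite /dr; move: Gt1 Gt2; rewrite /ccdf0; lra.
apply: (@le_trans _ _ (\int[mu]_(t in `]x, y]) (0 + (y - x) * p0 t))).
  apply: le_Rintegral => //; first exact: integrable_EFinB.
  move=> t /[dup]/Gle/andP[Gt1 Gt2]/=; rewrite in_itv/= => /andP[xt ty].
  have : 0 <= (y - t) * p0 t by rewrite mulr_ge0// subr_ge0.
  by rewrite /dr; move: Gt1 Gt2; rewrite /ccdf0; lra.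
by rewrite IE; lra.
Qed.

Lemma revenueB x y : 0 <= x -> x <= y ->
  r y - r x = \int[mu]_(t in `]x, y]) dr t.
Proof.
move=> x0 xy; apply/eqP; rewrite -subr_eq0 -normr_le0.
apply/ler_addgt0Pr => e e0; rewrite add0r.
pose n := Num.bound ((y - x) / e).
apply: (le_trans (marginal_revenue_error n x0 xy)).
have F1 : F y - F x <= 1.
  by have := cdf0_ge0 (P0 := P0) x; have := cdf0_le1 (P0 := P0) y; lra.
have yxn : (y - x) / 2 ^+ n <= e.
  rewrite ler_pdivrMr ?exprn_gt0// mulrC -ler_pdivrMr//.
  have : (y - x) / e < n%:R by apply: archi_boundP; rewrite divr_ge0 ?subr_ge0// ltW.
  move=> /ltW/le_trans; apply.
  by rewrite -natrX ler_nat ltnW// ltn_expl.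
rewrite -[e]mulr1; apply: ler_pM => //.
- by rewrite divr_ge0 ?subr_ge0// exprn_ge0.
- by rewrite subr_ge0 (cdf0_le hP0).
Qed.

Lemma revenueB_oo x y : 0 <= x -> x <= y ->
  r y - r x = \int[mu]_(t in `]x, y[) dr t.
Proof.
move=> x0 xy; rewrite revenueB// Rintegral_itv_bndo_bndc//.
apply: integrableS (marginal_revenue_integrable x y) => //.
exact: subset_itv_oo_oc.
Qed.

Lemma cdf0B_oo x y : x <= y -> F y - F x = \int[mu]_(t in `]x, y[) p0 t.
Proof.
move=> xy; rewrite (cdf0B hP0)// Rintegral_itv_bndo_bndc//.
exact: (density_integrable hP0).
Qed.

Lemma marginal_revenue_integrable_oo x y :
  mu.-integrable `]x, y[ (EFin \o dr).
Proof.
apply: integrableS (marginal_revenue_integrable x y) => //.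
exact: subset_itv_oo_oc.
Qed.

(** Comparing the marginal revenue with a multiple of the density, rather than
    with a constant, gives strict inequalities for the revenue as soon as the
    virtual value stays away from zero. *)
Lemma revenueB_le c x y : 0 <= x -> x <= y ->
  (forall t, x < t < y -> dr t <= c * p0 t) -> r y - r x <= c * (F y - F x).
Proof.
move=> x0 xy h; have ip := density_integrable hP0 (measurable_itv `]x, y[).
rewrite revenueB_oo// cdf0B_oo// -RintegralZl//.
apply: le_Rintegral => //; first exact: marginal_revenue_integrable_oo.
  exact: integrable_EFinZl.
Qed.

Lemma revenueB_ge c x y : 0 <= x -> x <= y ->
  (forall t, x < t < y -> c * p0 t <= dr t) -> c * (F y - F x) <= r y - r x.
Proof.
move=> x0 xy h; have ip := density_integrable hP0 (measurable_itv `]x, y[).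
rewrite revenueB_oo// cdf0B_oo// -RintegralZl//.
apply: le_Rintegral => //; last exact: marginal_revenue_integrable_oo.
exact: integrable_EFinZl.
Qed.

Lemma cdf0_lt x y : (forall t, 0 < t < 1 -> 0 < p0 t) ->
  0 <= x -> x < y -> y <= 1 -> F x < F y.
Proof.
move=> p_gt0 x0 xy y1; rewrite -subr_gt0 cdf0B_oo ?ltW//.
apply: (@Rintegral_gt0 _ _ _ x y) => //; first exact: (density_integrable hP0).
- by case: hP0.
- by move=> t /andP[xt ty]; apply: p_gt0;
  rewrite (le_lt_trans x0 xt)/= (lt_le_trans ty y1).
Qed.

Lemma marginal_revenueE t : 0 < p0 t -> dr t = - virtual_value P0 p0 t * p0 t.
Proof.
by move=> p_gt0; rewrite /dr /virtual_value opprB mulrBl divfK// gt_eqF.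
Qed.

(** The mode is a maximiser of the revenue.  A virtual value of the wrong sign
    at some point on the right or left of it would, by strict monotonicity, be
    bounded away from zero with that sign between this point and the mode, and
    the revenue would exceed its maximum. *)
Lemma regular_unimodal : regular P0 p0 ->
  exists xs, unimodal P0 xs.
Proof.
case=> p_gt0 phi_lt.
have F_lt x y : 0 <= x -> x < y -> y <= 1 -> F x < F y by exact: cdf0_lt.
have [xs + xs_max] : exists2 c, c \in `[0%R, 1%R] &
    forall t, t \in `[0%R, 1%R] -> r t <= r c.
  apply: EVT_max => //; apply: continuous_subspaceT.
  exact: (revenue_continuous hP0).
have r0 : r 0 = 0 by rewrite /revenue mul0r.
have r1 : r 1 = 0 by rewrite /revenue (ccdf0_eq0 hP0)// mulr0.
have r_gt0 x : 0 < x -> x < 1 -> 0 < r x.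
  move=> x0 x1; rewrite /revenue mulr_gt0// /ccdf0 subr_gt0 -(cdf0_1 hP0).
  by rewrite F_lt// ltW.
have rxs : 0 < r xs.
  apply: (@lt_le_trans _ _ (r (1/2))); first by apply: r_gt0; lra.
  by apply: xs_max; rewrite in_itv/=; apply/andP; split; lra.
rewrite in_itv/= !le_eqVlt => /andP[/predU1P[xs0|xs0] /predU1P[xs1|xs1]];
  do ?by move: rxs; rewrite -?xs0 ?xs1 ?r0 ?r1 ltxx.
pose phi := virtual_value P0 p0.
have up x y c : 0 <= x -> x <= y -> y <= 1 ->
    (forall t, x < t < y -> phi t <= - c) -> c * (F y - F x) <= r y - r x.
  move=> x0 xy y1 h; apply: revenueB_ge => // t /[dup] xty /andP[xt ty].
  have p_pos : 0 < p0 t by apply: p_gt0; lra.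
  rewrite marginal_revenueE//; apply: ler_wpM2r; first exact: ltW.
  by rewrite lerNr; exact: h.
have down x y c : 0 <= x -> x <= y -> y <= 1 ->
    (forall t, x < t < y -> c <= phi t) -> r y - r x <= - c * (F y - F x).
  move=> x0 xy y1 h; apply: revenueB_le => // t /[dup] xty /andP[xt ty].
  have p_pos : 0 < p0 t by apply: p_gt0; lra.
  rewrite marginal_revenueE//; apply: ler_wpM2r; first exact: ltW.
  by rewrite lerN2; exact: h.
have phi_gt0 t : xs < t -> t < 1 -> 0 < phi t.
  move=> xst t1; rewrite ltNge; apply/negP => phit.
  pose m := (xs + t) / 2.
  have [xm mt] : xs < m /\ m < t by rewrite /m; split; lra.
  have phim : phi m < phi t by apply: phi_lt => //; lra.
  have : - phi m * (F m - F xs) <= r m - r xs.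
    apply: up; [lra|lra|lra|] => s /andP[s1 s2]; rewrite opprK; apply/ltW/phi_lt; lra.
  have : 0 < - phi m * (F m - F xs).
    by apply: mulr_gt0; [lra|rewrite subr_gt0 F_lt//; lra].
  have : r m <= r xs by apply: xs_max; rewrite in_itv/=; apply/andP; split; lra.
  lra.
have phi_lt0 t : 0 < t -> t < xs -> phi t < 0.
  move=> t0 txs; rewrite ltNge; apply/negP => phit.
  pose m := (t + xs) / 2.
  have [tm mx] : t < m /\ m < xs by rewrite /m; split; lra.
  have phim : phi t < phi m by apply: phi_lt => //; lra.
  have : r xs - r m <= - phi m * (F xs - F m).
    apply: down; [lra|lra|lra|] => s /andP[s1 s2]; apply/ltW/phi_lt; lra.
  have : 0 < phi m * (F xs - F m).
    by apply: mulr_gt0; [lra|rewrite subr_gt0 F_lt//; lra].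
  have : r m <= r xs by apply: xs_max; rewrite in_itv/=; apply/andP; split; lra.
  lra.
exists xs; split; first by rewrite xs0 xs1.
- move=> x y x0 xy yxs; pose m := (x + y) / 2.
  have [xm my] : x < m /\ m < y by rewrite /m; split; lra.
  have phim : phi m < 0 by apply: phi_lt0; lra.
  have : - phi m * (F m - F x) <= r m - r x.
    apply: up; [lra|lra|lra|] => s /andP[s1 s2]; rewrite opprK; apply/ltW/phi_lt; lra.
  have : 0 < - phi m * (F m - F x).
    by apply: mulr_gt0; [lra|rewrite subr_gt0 F_lt//; lra].
  have : 0 * (F y - F m) <= r y - r m.
    apply: up; [lra|lra|lra|] => s /andP[s1 s2]; rewrite oppr0; apply/ltW/phi_lt0; lra.
  lra.
- move=> x y x0 xy y1; pose m := (x + y) / 2.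
  have [xm my] : x < m /\ m < y by rewrite /m; split; lra.
  have phim : 0 < phi m by apply: phi_gt0; lra.
  have : r y - r m <= - phi m * (F y - F m).
    apply: down; [lra|lra|lra|] => s /andP[s1 s2]; apply/ltW/phi_lt; lra.
  have : 0 < phi m * (F y - F m).
    by apply: mulr_gt0; [lra|rewrite subr_gt0 F_lt//; lra].
  have : r m - r x <= - 0 * (F m - F x).
    apply: down; [lra|lra|lra|] => s /andP[s1 s2]; apply/ltW/phi_gt0; lra.
  lra.
Qed.

End regularity.

(** * Pairs of valuations with equal revenue *)

(** The two solutions of the equation [revenue x = pi] for a level pi strictly
    between 0 and the maximal revenue. *)
Definition level_pair {R : realType} (P0 : probability (measurableTypeR R) R)
    (xs u w : R) : Prop :=
  [/\ 0 < u, u < xs, xs < w, w < 1 & revenue P0 u = revenue P0 w].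

Section level_pairs.
Context {R : realType} {P0 : probability (measurableTypeR R) R} {p0 : R -> R}.
Context (hP0 : continuous_on_unit P0 p0).
Context {xs : R}.
Context (r_unimodal : unimodal P0 xs).
Local Notation G := (ccdf0 P0).
Local Notation r := (revenue P0).

Lemma revenue0 : r 0 = 0. Proof. by rewrite /revenue mul0r. Qed.

Lemma revenue_eq0 x : 1 <= x -> r x = 0.
Proof. by move=> x1; rewrite /revenue (ccdf0_eq0 hP0)// mulr0. Qed.

Lemma revenue_gt0 x : 0 < x -> x < 1 -> 0 < r x.
Proof.
case: r_unimodal => _ inc dec x0 x1; have [xxs|/ltW xsx] := leP x xs.
  by rewrite -revenue0; apply: inc.
by rewrite -(revenue_eq0 (lexx 1)); apply: dec.
Qed.

Lemma revenue_le_max x : 0 <= x -> x <= 1 -> r x <= r xs.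
Proof.
case: r_unimodal => /andP[xs0 xs1] inc dec x0 x1.
have [xxs|xxs|->//] := ltgtP x xs; apply: ltW; first exact: inc.
exact: dec.
Qed.

Lemma Pi0E : Pi0 P0 = r xs.
Proof.
have [/andP[xs0 xs1] _ _] := r_unimodal.
have Exs : [set r x | x in `[0, 1]] (r xs).
  by exists xs => //=; rewrite in_itv/= !ltW.
have ub : ubound [set r x | x in `[0, 1]] (r xs).
  by move=> _ [x /= + <-]; rewrite in_itv/= => /andP[x0 x1]; exact: revenue_le_max.
apply/eqP; rewrite eq_le ge_sup//=; last by exists (r xs).
by apply: ub_le_sup => //; exists (r xs).
Qed.

Lemma level_pair_lt_mid u w x : level_pair P0 xs u w -> u < x < w -> r u < r x.
Proof.
case: r_unimodal => _ inc dec [u0 uxs xsw w1 ruw] /andP[ux xw].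
have [xxs|/ltW xsx] := leP x xs; first by apply: inc => //; exact: ltW.
by rewrite ruw; apply: dec => //; exact: ltW.
Qed.

Lemma level_pair_gt_left u w x : level_pair P0 xs u w -> 0 <= x < u -> r x < r u.
Proof.
case: r_unimodal => _ inc dec [u0 uxs xsw w1 ruw] /andP[x0 xu].
by apply: inc => //; exact: ltW.
Qed.

Lemma level_pair_gt_right u w x : level_pair P0 xs u w -> w < x <= 1 -> r x < r u.
Proof.
case: r_unimodal => _ inc dec [u0 uxs xsw w1 ruw] /andP[wx x1].
by rewrite ruw; apply: dec => //; exact: ltW.
Qed.

Lemma level_pair_set u w : level_pair P0 xs u w ->
  [set x | 0 <= x <= 1 /\ r x = r u] = [set u; w].
Proof.
move=> h; have [u0 uxs xsw w1 ruw] := h.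
apply/seteqP; split => x /=.
  move=> [/andP[x0 x1] rx].
  have [xu|ux|->] := ltgtP x u; last by left.
    have := level_pair_gt_left (x := x) h; rewrite x0 xu rx ltxx.
    by move=> /(_ isT).
  have [xw|wx|->] := ltgtP x w; last by right.
    have := level_pair_lt_mid (x := x) h; rewrite ux xw rx ltxx.
    by move=> /(_ isT).
  have := level_pair_gt_right (x := x) h; rewrite wx x1 rx ltxx.
  by move=> /(_ isT).
by case=> ->; split => //; apply/andP; split; lra.
Qed.

Lemma u_solE u w : level_pair P0 xs u w -> u_sol P0 (r u) = u.
Proof.
move=> h; have [u0 uxs xsw w1 ruw] := h; rewrite /u_sol (level_pair_set h).
have lb : lbound [set u; w] u by move=> x [] ->; lra.
apply/eqP; rewrite eq_le lb_le_inf//= ?andbT; last by exists u; left.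
by apply: ge_inf; [exists u|left].
Qed.

Lemma w_solE u w : level_pair P0 xs u w -> w_sol P0 (r u) = w.
Proof.
move=> h; have [u0 uxs xsw w1 ruw] := h; rewrite /w_sol (level_pair_set h).
have ub : ubound [set u; w] w by move=> x [] ->; lra.
apply/eqP; rewrite eq_le ge_sup//=; last by exists u; left.
by apply: ub_le_sup; [exists w|right].
Qed.

(** The pairs can be parametrised by their ratio s, which is what the
    first-order conditions prescribe: r(s x) - r(x) is nonnegative where s x is
    the mode and negative where s x = 1. *)
Lemma level_pair_ratio s : 1 < s -> exists u, level_pair P0 xs u (s * u).
Proof.
have [/andP[xs0 xs1] inc dec] := r_unimodal => s1.
have s0 : 0 < s by lra.
have cg : continuous (fun x => r (s * x) - r x).
  move=> x; apply: cvgB; last exact: (revenue_continuous hP0).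
  apply: (@continuous_comp _ _ _ ( *%R s) r); first exact: mulrl_continuous.
  exact: (revenue_continuous hP0).
have ab : xs / s <= 1 / s by rewrite ler_pM2r ?invr_gt0// ltW.
have sxs : s * (xs / s) = xs by rewrite mulrC divfK ?gt_eqF.
have s1s : s * (1 / s) = 1 by rewrite mulrC divfK ?gt_eqF.
have a0 : 0 < xs / s by rewrite divr_gt0.
have b1 : 1 / s < 1 by rewrite ltr_pdivrMr// mul1r.
have [|u] := @IVT _ (fun x => r (s * x) - r x) _ _ 0 ab (continuous_subspaceT cg).
  rewrite sxs s1s (revenue_eq0 (lexx 1)).
  have rb : 0 < r (1 / s) by apply: revenue_gt0 => //; rewrite divr_gt0.
  have ra : r (xs / s) <= r xs by apply: revenue_le_max; lra.
  by rewrite ge_min le_max; apply/andP; split; apply/orP; [right|left]; lra.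
rewrite in_itv/= => /andP[au ub] /eqP; rewrite subr_eq0 => /eqP rsu.
have u0 : 0 < u by exact: lt_le_trans au.
have su1 : s * u <= 1 by rewrite -s1s ler_pM2l.
have xsu : xs <= s * u by rewrite -sxs ler_pM2l.
have usu : u < s * u by rewrite ltr_pMl.
have uxs : u < xs.
  by rewrite ltNge; apply/negP => xu; have := dec u (s * u) xu usu su1; rewrite rsu ltxx.
have xssu : xs < s * u.
  rewrite ltNge; apply/negP => xu; have := inc u (s * u) (ltW u0) usu xu.
  by rewrite rsu ltxx.
exists u; split => //; rewrite lt_neqAle su1 andbT; apply/eqP => su.
by have := revenue_gt0 u0 (lt_trans uxs xs1); rewrite -rsu su revenue_eq0 ?ltxx.
Qed.

End level_pairs.

(** * Parameters of the optimal screening mechanism *)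

Section robust_screening.
Context {R : realType} {P0 : probability (measurableTypeR R) R} {p0 : R -> R}.
Context (hP0 : continuous_on_unit P0 p0).
Context {xs : R}.
Context (r_unimodal : unimodal P0 xs).
Local Notation mu := (@lebesgue_measure R).
Local Notation G := (ccdf0 P0).
Local Notation r := (revenue P0).

(* The integrals are taken over ]0, 1] to discard the value at 0, where the
   quotient by x is meaningless. *)
Let shortfall (pi x : R) := pos_part (G x - pi / x).
Let J (pi : R) := \int[mu]_(x in `]0, 1]) shortfall pi x.

Lemma virtual_margin_integrable (pi a b : R) : 0 < a ->
  mu.-integrable `]a, b] (EFin \o (fun x => G x - pi / x)).
Proof.
move=> a0; apply: integrable_in_continuous_itv => x /andP[ax _].
apply: cvgB; first exact: (ccdf0_continuous hP0).
apply: cvgM; first exact: cvg_cst.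
by apply: inv_continuous; rewrite gt_eqF// (lt_le_trans a0).
Qed.

Lemma virtual_margin_integral (pi a b : R) : 0 < a -> a < b ->
  \int[mu]_(x in `]a, b]) (G x - pi / x) =
  \int[mu]_(x in `]a, b]) G x - pi * ln (b / a).
Proof.
move=> a0 ab.
have iV : mu.-integrable `]a, b] (EFin \o (@GRing.inv R)).
  apply: integrable_in_continuous_itv => x /andP[ax _].
  by apply: inv_continuous; rewrite gt_eqF// (lt_le_trans a0).
have iG : mu.-integrable `]a, b] (EFin \o G).
  exact/continuous_integrable_itv/(ccdf0_continuous hP0).
rewrite RintegralB//; last exact: integrable_EFinZl.
by rewrite RintegralZl// Rintegral_inv.
Qed.

Lemma shortfall_ge0 pi x : 0 <= shortfall pi x.
Proof. by rewrite /shortfall /pos_part le_max lexx orbT. Qed.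

Lemma shortfall_le1 pi x : 0 <= pi -> 0 <= x -> shortfall pi x <= 1.
Proof.
move=> pi0 x0; rewrite /shortfall /pos_part ge_max ler01 andbT.
have : 0 <= pi / x by rewrite divr_ge0.
by have := ccdf0_le1 (P0 := P0) x; lra.
Qed.

Lemma shortfall_integrable pi : 0 <= pi ->
  mu.-integrable `]0, 1] (EFin \o shortfall pi).
Proof.
move=> pi0.
have i1 : mu.-integrable `]0%R, 1%R] (EFin \o cst (1 : R)).
  by apply: continuous_integrable_itv => z; exact: cst_continuous.
apply: le_integrable i1 => //.
- apply/measurable_EFinP;
  apply: (@measurable_maxr _ _ _ _ (fun x => G x - pi / x) (cst 0)) => //.
  apply: subspace_continuous_measurable_fun => //.
  apply: continuous_in_subspaceT => x /set_mem/=; rewrite in_itv/= => /andP[x0 _].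
  apply: cvgB; first exact: (ccdf0_continuous hP0).
  apply: cvgM; first exact: cvg_cst.
  by apply: inv_continuous; rewrite gt_eqF.
- move=> x /=; rewrite in_itv/= => /andP[x0 _].
  by rewrite lee_fin normr1 ger0_norm ?shortfall_ge0// shortfall_le1// ltW.
Qed.

Lemma RS_objE k pi : 0 <= pi -> RS_obj P0 k pi = pi + k * J pi.
Proof.
move=> pi0; rewrite /RS_obj -Rintegral_itv_obnd_cbnd//.
exact: shortfall_integrable.
Qed.

Lemma shortfall_integral_ge0 pi : 0 <= J pi.
Proof. by apply: Rintegral_ge0 => x _; exact: shortfall_ge0. Qed.

Lemma shortfall_integral_le1 pi : 0 <= pi -> J pi <= 1.
Proof.
move=> pi0; apply: (@le_trans _ _ (\int[mu]_(x in `]0%R, 1%R]) 1)).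
  apply: le_Rintegral => //; first exact: shortfall_integrable.
    by apply: continuous_integrable_itv => z; exact: cst_continuous.
  move=> x /=; rewrite in_itv/= => /andP[x0 _]; apply: shortfall_le1 => //; exact: ltW.
by rewrite Rintegral_cst_itv// mul1r subr0.
Qed.

Lemma shortfall_gt0 pi x : 0 < x -> pi < r x -> 0 < shortfall pi x.
Proof.
move=> x0 pir; rewrite /shortfall /pos_part lt_max subr_gt0.
by rewrite ltr_pdivrMr// mulrC pir.
Qed.

(** The revenue increases at rate at most one, as G is nonincreasing and bounded
    by one.  This gives explicit intervals next to a point on which the revenue
    stays on one side of a given level. *)
Lemma revenue_right x y : 0 <= x -> x <= y -> r y <= r x + (y - x).
Proof.
move=> x0 xy; rewrite /revenue.
have : y * G y <= y * G x by rewrite ler_wpM2l ?(ccdf0_le hP0)// (le_trans x0).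
have : (y - x) * G x <= (y - x) * 1.
  by rewrite ler_wpM2l ?subr_ge0// ccdf0_le1.
lra.
Qed.

Lemma shortfall_integral_gt0 pi : 0 <= pi -> pi < r xs -> 0 < J pi.
Proof.
have [/andP[xs0 xs1] _ _] := r_unimodal.
move=> pi0 pir; apply: (@Rintegral_gt0 _ _ _ (Num.max 0 (xs - (r xs - pi))) xs) => //.
- exact: shortfall_integrable.
- by rewrite gt_max xs0/=; lra.
- move=> x /=; rewrite !in_itv/= gt_max => /andP[/andP[x0 _] xxs].
  by rewrite x0/= ltW// (lt_trans xxs).
- by move=> x _; exact: shortfall_ge0.
- move=> x /andP[]; rewrite gt_max => /andP[x0 xx] xxs; apply: shortfall_gt0 => //.
  by have := revenue_right (ltW x0) (ltW xxs); lra.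
Qed.

Section pair.
Context {u w : R}.
Context (uw : level_pair P0 xs u w).

(** The sign of G(x) - pi / x is that of r(x) - pi, so at the level of the pair
    the positive part is the integrand itself on ]u, w] and 0 elsewhere. *)
Lemma shortfall_integral_level : J (r u) =
  \int[mu]_(x in `]u, w]) G x - r u * ln (w / u).
Proof.
have [u0 uxs xsw w1 ruw] := uw.
rewrite -virtual_margin_integral//; last exact: lt_trans xsw.
have -> : `]u, w]%classic = `]0%R, 1%R] `&` `]u, w]%classic.
  rewrite setIidr//; apply: subset_itv; rewrite bnd_simp ltW//.
rewrite Rintegral_mkcondr; apply: eq_Rintegral => x /set_mem/=.
rewrite in_itv/= => /andP[x0 x1].
have xrE : x * (G x - r u / x) = r x - r u.
  by rewrite mulrBr mulrCA mulfV ?gt_eqF// mulr1.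
rewrite patchE /shortfall /pos_part; case: ifPn => /= [|].
  rewrite inE/= in_itv/= => /andP[ux xw].
  apply/max_idPl; rewrite -(pmulr_rge0 _ x0) xrE subr_ge0.
  move: xw; rewrite le_eqVlt => /predU1P[->|xw]; first by rewrite ruw.
  by apply: ltW; apply: (level_pair_lt_mid r_unimodal uw); rewrite ux.
rewrite notin_setE/= in_itv/= => /negP; rewrite negb_and -leNgt -ltNge => h.
apply/max_idPr; rewrite -(pmulr_rle0 _ x0) xrE subr_le0.
case/orP: h => [|wx].
  rewrite le_eqVlt => /predU1P[->//|xu].
  by apply: ltW; apply: (level_pair_gt_left r_unimodal uw); rewrite ltW.
by apply: ltW; apply: (level_pair_gt_right r_unimodal uw); rewrite wx.
Qed.

(** The positive part dominates the integrand restricted to ]u, w].  For a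
    level pi below r(u) this is strict just to the left of u, where the revenue
    still exceeds pi; for a level above r(u) it is strict just to the right of
    u, where the revenue is still below pi. *)
Lemma shortfall_integral_gt pi : 0 <= pi -> pi != r u ->
  \int[mu]_(x in `]u, w]) G x - pi * ln (w / u) < J pi.
Proof.
have [u0 uxs xsw w1 ruw] := uw; move=> pi0 pir.
have u_lt_w : u < w by exact: lt_trans xsw.
rewrite -virtual_margin_integral//.
have sub : `]u, w]%classic `<=` `]0%R, 1%R]%classic.
  by apply: subset_itv; rewrite bnd_simp ltW.
rewrite -{1}(setIidr sub) Rintegral_mkcondr.
have le_sf x : ((fun x => G x - pi / x) \_ `]u, w]) x <= shortfall pi x.
  rewrite patchE /shortfall /pos_part; case: ifPn => _ /=.
    by rewrite le_max lexx.
  by rewrite le_max lexx orbT.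
have ir : mu.-integrable `]0%R, 1%R]
    (EFin \o ((fun x => G x - pi / x) \_ `]u, w])).
  rewrite -restrict_EFin; apply/integrable_restrict => //.
  by rewrite setIidr//; exact: virtual_margin_integrable.
pose a := Num.max 0 (u - (r u - pi)); pose b := Num.min w (u + (pi - r u)).
have [lt_pi|lt_pi] : pi < r u \/ r u < pi by case: ltgtP pir; [left|right|].
- apply: (@lt_Rintegral _ _ _ _ a u) => //.
  + exact: shortfall_integrable.
  + by rewrite gt_max u0/=; lra.
  + move=> x /=; rewrite !in_itv/= gt_max => /andP[/andP[x0 _] xxs]; lra.
  + move=> x /andP[]; rewrite gt_max => /andP[x0 xx] xu.
    rewrite patchE memNset/=; last by rewrite in_itv/= ltNge (ltW xu).
    apply: shortfall_gt0 => //.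
    by have := revenue_right (ltW x0) (ltW xu); lra.
- apply: (@lt_Rintegral _ _ _ _ u b) => //.
  + exact: shortfall_integrable.
  + by rewrite lt_min u_lt_w/=; lra.
  + move=> x /=; rewrite !in_itv/= lt_min => /andP[ux /andP[xw _]]; lra.
  + move=> x /andP[ux]; rewrite lt_min => /andP[xw xx].
    rewrite patchE mem_set/=; last by rewrite in_itv/= ux ltW.
    apply: (@lt_le_trans _ _ 0); last exact: shortfall_ge0.
    have x0 : 0 < x by exact: lt_trans ux.
    rewrite -(pmulr_rlt0 _ x0) mulrBr mulrCA mulfV ?gt_eqF// mulr1 subr_lt0.
    by have := revenue_right (ltW u0) (ltW ux); rewrite -[x * G x]/(r x); lra.
Qed.

Lemma RS_obj_level k : k * ln (w / u) = 1 ->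
  RS_obj P0 k (r u) = k * \int[mu]_(x in `]u, w]) G x.
Proof.
have [u0 uxs xsw w1 ruw] := uw; move=> kuw.
have ru0 : 0 <= r u by rewrite mulr_ge0 ?(ccdf0_ge0 (P0 := P0))// ltW.
rewrite RS_objE// shortfall_integral_level mulrBr mulrCA kuw; ring.
Qed.

(** The bound of [shortfall_integral_gt] is affine in pi with slope
    - ln (w / u), so after multiplication by k it cancels the term pi of the
    objective. *)
Lemma RS_obj_gt k pi : 0 < k -> k * ln (w / u) = 1 -> 0 <= pi ->
  pi != r u -> RS_obj P0 k (r u) < RS_obj P0 k pi.
Proof.
move=> k0 kuw pi0 pir; rewrite RS_obj_level// RS_objE//.
have := shortfall_integral_gt pi0 pir; rewrite -(ltr_pM2l k0) mulrBr mulrCA kuw.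
lra.
Qed.

Lemma level_in_range : r u \in `[0, Pi0 P0].
Proof.
have [u0 uxs xsw w1 ruw] := uw; rewrite in_itv/= (Pi0E r_unimodal).
rewrite mulr_ge0 ?(ccdf0_ge0 (P0 := P0)) ?(ltW u0)//=.
by apply: (revenue_le_max r_unimodal); lra.
Qed.

Lemma pi_RSE k : 0 < k -> k * ln (w / u) = 1 -> pi_RS P0 k = r u.
Proof.
move=> k0 kuw; apply: xget_unique => [|pi []] /=.
  split; first exact: level_in_range.
  move=> pi /=; rewrite in_itv/= => /andP[pi0 _].
  by have [->//|/(RS_obj_gt k0 kuw pi0)/ltW] := eqVneq pi (r u).
rewrite in_itv/= => /andP[pi0 _] pimin; apply/eqP; apply: contraT.
move=> /(RS_obj_gt k0 kuw pi0); rewrite ltNge pimin//; exact: level_in_range.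
Qed.

Lemma rho_RSE k : 0 < k -> k * ln (w / u) = 1 ->
  rho_RS P0 k = RS_obj P0 k (r u).
Proof.
move=> k0 kuw; rewrite /rho_RS.
have lb : lbound [set RS_obj P0 k pi | pi in `[0, Pi0 P0]] (RS_obj P0 k (r u)).
  move=> _ [pi /= + <-]; rewrite in_itv/= => /andP[pi0 _].
  by have [->//|/(RS_obj_gt k0 kuw pi0)/ltW] := eqVneq pi (r u).
have ex : [set RS_obj P0 k pi | pi in `[0, Pi0 P0]] (RS_obj P0 k (r u)).
  by exists (r u) => //; exact: level_in_range.
apply/eqP; rewrite eq_le lb_le_inf//= ?andbT; last by exists (RS_obj P0 k (r u)).
by apply: ge_inf => //; exists (RS_obj P0 k (r u)).
Qed.

End pair.

Lemma RS_level_pair k : 0 < k -> exists u w, level_pair P0 xs u w /\ k * ln (w / u) = 1.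
Proof.
move=> k0; have s1 : 1 < expR k^-1 by rewrite expR_gt1 invr_gt0.
have [u uw] := level_pair_ratio hP0 r_unimodal s1.
exists u, (expR k^-1 * u); split=> //; have [u0 _ _ _ _] := uw.
by rewrite mulfK ?gt_eqF// expRK mulfV// gt_eqF.
Qed.

Lemma rho_RS_le k pi : 0 < k -> pi \in `[0, Pi0 P0] -> rho_RS P0 k <= RS_obj P0 k pi.
Proof.
move=> k0 pi_in; apply: ge_inf; last by exists pi.
exists 0 => _ [y /= + <-]; rewrite in_itv/= => /andP[y0 _].
rewrite RS_objE// addr_ge0// mulr_ge0 ?shortfall_integral_ge0//; exact: ltW.
Qed.

Lemma rho_RS_attained k : 0 < k ->
  exists2 pi, pi \in `[0, Pi0 P0] & rho_RS P0 k = RS_obj P0 k pi.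
Proof.
move=> k0; have [u [w [uw kuw]]] := RS_level_pair k0.
by exists (r u); [exact: level_in_range uw|exact: rho_RSE uw _ _ _].
Qed.

(** For each pi the objective is affine in k with slope in [0,1]; evaluating the
    objective of l at the minimiser for k gives the estimate. *)
Lemma rho_RS_lip k l : 0 < k -> 0 < l -> rho_RS P0 l <= rho_RS P0 k + `|l - k|.
Proof.
move=> k0 l0; have [pi pi_in ->] := rho_RS_attained k0.
apply: (le_trans (rho_RS_le l0 pi_in)).
move: pi_in; rewrite in_itv/= => /andP[pi0 _]; rewrite !RS_objE//.
have J0 := shortfall_integral_ge0 pi; have J1 := shortfall_integral_le1 pi0.
have : (l - k) * J pi <= `|l - k|.
  by rewrite (le_trans (ler_norm _))// normrM (ger0_norm J0) ler_piMr.
lra.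
Qed.

Lemma rho_RS_continuous k : 0 < k -> {for k, continuous (rho_RS P0)}.
Proof.
move=> k0; apply/cvgrPdist_le => e e0; near=> l.
have l0 : 0 < l by near: l; exact: lt_nbhsr.
have le1 : `|k - l| <= e by near: l; apply: cvgr_dist_le.
rewrite ler_norml; apply/andP; split.
  by have := rho_RS_lip k0 l0; move: le1; rewrite distrC; lra.
by have := rho_RS_lip l0 k0; move: le1; lra.
Unshelve. all: by end_near. Qed.

(** Intermediate value theorem between k = tau, where the choice pi = 0 already
    costs at most tau, and k = tau / J(tau), where every pi < tau costs at least
    k J(tau) = tau because J is nonincreasing. *)
Lemma rho_RS_surjective tau : 0 < tau < Pi0 P0 ->
  exists2 k, 0 < k & rho_RS P0 k = tau.
Proof.
move=> /andP[tau0 tauPi].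
have Jtau : 0 < J tau.
  by apply: shortfall_integral_gt0; rewrite -?(Pi0E r_unimodal)// ltW.
pose K := tau / J tau.
have tauK : tau <= K.
  by rewrite ler_pdivlMr// ler_piMr ?shortfall_integral_le1 ?ltW.
have low : rho_RS P0 tau <= tau.
  apply: (le_trans (rho_RS_le (pi := 0) tau0 _)).
    by rewrite in_itv/= lexx/= ltW// (lt_trans tau0).
  rewrite RS_objE// add0r; apply: ler_piMr; first exact: ltW.
  exact: shortfall_integral_le1.
have high : tau <= rho_RS P0 K.
  have K0 : 0 < K by exact: lt_le_trans tauK.
  have [pi + ->] := rho_RS_attained K0; rewrite in_itv/= => /andP[pi0 _].
  rewrite RS_objE//; have [taupi|pitau] := leP tau pi.
    have : 0 <= K * J pi by rewrite mulr_ge0 ?shortfall_integral_ge0// ltW.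
    by lra.
  have : K * J tau <= K * J pi.
    rewrite ler_pM2l//; apply: le_Rintegral => //; try exact: shortfall_integrable.
    - exact/shortfall_integrable/ltW.
    - move=> x /=; rewrite in_itv/= => /andP[x0 _].
      rewrite /shortfall /pos_part ge_max !le_max lexx !orbT andbT.
      by rewrite lerD2l lerN2 ler_pM2r ?invr_gt0// ltW.
  rewrite /K divfK ?gt_eqF//; lra.
have cr : {within `[tau, K], continuous (rho_RS P0)}.
  apply: continuous_in_subspaceT => k /set_mem/=; rewrite in_itv/= => /andP[tk _].
  by apply: rho_RS_continuous; exact: lt_le_trans tk.
have [|k] := IVT tauK cr (v := tau); first by rewrite ge_min le_max low high orbT.
by rewrite in_itv/= => /andP[tk _] <-; exists k => //; exact: lt_le_trans tk.
Qed.

(** All that the comparison needs to know about the screening mechanism. *)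
Lemma RS_mechanism_parameters tau : 0 < tau < Pi0 P0 ->
  [/\ 0 < k_RS P0 tau, level_pair P0 xs (u_RS P0 tau) (w_RS P0 tau),
    k_RS P0 tau * ln (w_RS P0 tau / u_RS P0 tau) = 1 &
    k_RS P0 tau * \int[mu]_(x in `]u_RS P0 tau, w_RS P0 tau]) G x = tau].
Proof.
move=> /rho_RS_surjective[k0 k00 rk0].
have [k_gt0 rk] : 0 < k_RS P0 tau /\ rho_RS P0 (k_RS P0 tau) = tau.
  by apply: (@xgetPex _ 0 [set k | 0 < k /\ rho_RS P0 k = tau]); exists k0.
have [u [w [uw kuw]]] := RS_level_pair k_gt0.
have uE : u_RS P0 tau = u by rewrite /u_RS (pi_RSE uw)// (u_solE r_unimodal uw).
have wE : w_RS P0 tau = w by rewrite /w_RS (pi_RSE uw)// (w_solE r_unimodal uw).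
by rewrite uE wE; split=> //; rewrite -(RS_obj_level uw)// -(rho_RSE uw).
Qed.

End robust_screening.

(** * Utility of the buyer *)

Definition utility_RS {R : realType}
  (P0 : probability (measurableTypeR R) R) (tau v : R) : R :=
  q_RS P0 tau v * v - m_RS P0 tau v.

Definition utility_PP {R : realType}
  (P0 : probability (measurableTypeR R) R) (tau v : R) : R :=
  q_PP P0 tau v * v - m_PP P0 tau v.

Section buyer_utility.
Context {R : realType} {P0 : probability (measurableTypeR R) R} {tau : R}.
Local Notation k := (k_RS P0 tau).
Local Notation u := (u_RS P0 tau).
Local Notation w := (w_RS P0 tau).
Context (k_gt0 : 0 < k) (u_gt0 : 0 < u) (uw : u < w) (kuw : k * ln (w / u) = 1).

Local Notation U := (utility_RS P0 tau).

Lemma utility_RS_low v : v <= u -> U v = 0.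
Proof.
rewrite /utility_RS /q_RS /m_RS le_eqVlt => /predU1P[->|->].
  by rewrite ltxx uw divff ?gt_eqF// ln1; ring.
by rewrite mul0r subrr.
Qed.

(** At v = w this is where k ln (w / u) = 1 is used: the middle branch takes
    over the value of the upper one, so the surplus does not jump. *)
Lemma utility_RS_mid v : u <= v -> v <= w ->
  U v = k * (v * ln (v / u) - (v - u)).
Proof.
rewrite /utility_RS /q_RS /m_RS leNgt => /negbTE ->.
rewrite le_eqVlt => /predU1P[->|->]; last by ring.
by rewrite ltxx [RHS]mulrBr [X in _ = X - _]mulrCA kuw; ring.
Qed.

Lemma utility_RS_high v : w <= v -> U v = v - k * (w - u).
Proof.
move=> wv; rewrite /utility_RS /q_RS /m_RS.
by rewrite !ltNge (le_trans (ltW uw) wv) wv /= mul1r.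
Qed.

(** The bounds are those of the slope k ln (v / u), which lies in [0,1]; both
    follow from ln z <= z - 1 applied to y / x and x / y. *)
Lemma utility_RS_mid_incr x y : u <= x -> x <= y -> y <= w ->
  0 <= U y - U x <= y - x.
Proof.
move=> ux xy yw; have x0 : 0 < x by exact: lt_le_trans ux.
have y0 : 0 < y by exact: lt_le_trans xy.
rewrite (utility_RS_mid ux (le_trans xy yw)) (utility_RS_mid (le_trans ux xy) yw).
rewrite -mulrBr !ln_div ?posrE//.
have lnxy : ln y - ln x <= y / x - 1.
  rewrite -ln_div ?posrE//; apply: le_trans (le_ln1Dx _); rewrite ?subrKC//.
  by rewrite ltrBrDl subrr divr_gt0.
have lnyx : ln x - ln y <= x / y - 1.
  rewrite -ln_div ?posrE//; apply: le_trans (le_ln1Dx _); rewrite ?subrKC//.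
  by rewrite ltrBrDl subrr divr_gt0.
have h1 : x * (ln y - ln x) <= y - x.
  by rewrite -(ler_pM2l x0) in lnxy; rewrite (le_trans lnxy)//
    mulrBr mulrCA divff ?gt_eqF//; lra.
have h2 : y * (ln x - ln y) <= x - y.
  by rewrite -(ler_pM2l y0) in lnyx; rewrite (le_trans lnyx)//
    mulrBr mulrCA divff ?gt_eqF//; lra.
have lux : ln u <= ln x by rewrite ler_ln ?posrE.
have lyw : ln y <= ln w by rewrite ler_ln ?posrE// (lt_trans u_gt0).
have kuw' : k * (ln w - ln u) = 1.
  by rewrite -ln_div ?posrE// (lt_trans u_gt0).
have h3 : 0 <= (y - x) * (ln x - ln u) by apply: mulr_ge0; lra.
have h4 : 0 <= (y - x) * (ln w - ln y) by apply: mulr_ge0; lra.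
apply/andP; split; first by rewrite pmulr_rge0//; lra.
rewrite -[leRHS]mul1r -kuw' -mulrA ler_pM2l//; lra.
Qed.

Lemma utility_RS_incr x y : x <= y -> 0 <= U y - U x <= y - x.
Proof.
move=> xy.
have low x' y' : x' <= y' -> y' <= u -> 0 <= U y' - U x' <= y' - x'.
  move=> xy' yu; rewrite !utility_RS_low//; last exact: le_trans yu.
  by rewrite subrr lexx subr_ge0.
have high x' y' : x' <= y' -> w <= x' -> 0 <= U y' - U x' <= y' - x'.
  move=> xy' wx; rewrite !utility_RS_high//; last exact: le_trans xy'.
  apply/andP; split; lra.
have mid := utility_RS_mid_incr.
have uw' := ltW uw.
have [xu|/ltW ux] := leP x u.
  have [yu|/ltW uy] := leP y u; first exact: low.
  have /andP[a1 a2] := low _ _ xu (lexx _).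
  have [yw|/ltW wy] := leP y w.
    by have /andP[b1 b2] := mid _ _ (lexx u) uy yw; apply/andP; split; lra.
  have /andP[b1 b2] := mid _ _ (lexx u) uw' (lexx w).
  by have /andP[c1 c2] := high _ _ wy (lexx w); apply/andP; split; lra.
have [wx|/ltW xw] := leP w x; first exact: high.
have [yw|/ltW wy] := leP y w; first exact: mid.
have /andP[b1 b2] := mid _ _ ux xw (lexx w).
by have /andP[c1 c2] := high _ _ wy (lexx w); apply/andP; split; lra.
Qed.

Lemma utility_RS_ge0 v : 0 <= v -> 0 <= U v.
Proof.
move=> v0; have := utility_RS_incr v0; rewrite (utility_RS_low (ltW u_gt0)).
by rewrite subr0 => /andP[].
Qed.

Lemma utility_PP_low v : v < p_PP P0 tau -> utility_PP P0 tau v = 0.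
Proof. by rewrite /utility_PP /q_PP /m_PP leNgt => ->; rewrite mul0r subrr. Qed.

Lemma utility_PP_high v : p_PP P0 tau <= v -> utility_PP P0 tau v = v - p_PP P0 tau.
Proof. by rewrite /utility_PP /q_PP /m_PP => ->; rewrite mul1r. Qed.

Lemma price_PP_itv (P : probability (measurableTypeR R) R) k0 : 0 <= price_PP P k0 <= 1.
Proof.
rewrite /price_PP /argmax; case: xgetP => [x -> /= [] |_]; last by rewrite lexx ler01.
by rewrite in_itv.
Qed.

(** The threshold is the supremum of the valuations above the price that weakly
    prefer screening.  Below it, the preference persists since the surplus has
    slope at most one; at the supremum itself it persists since the surplus is
    nondecreasing. *)
Lemma utility_threshold :
  exists2 vbar, p_PP P0 tau <= vbar <= 1 &
    forall v, 0 <= v <= 1 ->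
      (utility_PP P0 tau v <= U v <-> v <= vbar).
Proof.
have /andP[] := price_PP_itv P0 (k_PP P0 tau); rewrite -/(p_PP P0 tau).
set p := p_PP P0 tau => p0 p1.
pose S := [set v | p <= v <= 1 /\ v - p <= U v].
have Sp : S p by split; [rewrite lexx|rewrite subrr utility_RS_ge0].
have ubS : ubound S 1 by move=> v [/andP[]].
have hsS : has_sup S by split; [exists p|exists 1].
have leS v : S v -> v <= sup S by move=> Sv; apply: ub_le_sup => //; exists 1.
exists (sup S); first by rewrite leS// ge_sup//; exists p.
move=> v /andP[v0 v1]; have [pv|vp] := leP p v; last first.
  rewrite utility_PP_low//; split=> _; last exact: utility_RS_ge0.
  exact: le_trans (ltW vp) (leS _ Sp).
rewrite utility_PP_high//; split=> [pU|vS].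
  by apply: leS; split=> //; rewrite pv.
apply/ler_addgt0Pr => e e0.
have [s [/andP[ps s1] sU] vs] := sup_adherent e0 hsS.
have [sv|/ltW vs'] := leP s v.
  by have := utility_RS_incr sv; rewrite -/p; lra.
by have := utility_RS_incr vs'; rewrite -/p; lra.
Qed.

(** Above the price the advantage of screening is nonincreasing, so it suffices
    to look at v = 1. *)
Lemma utility_RS_dominates : w <= 1 -> k * (w - u) <= p_PP P0 tau ->
  forall v, 0 <= v <= 1 -> utility_PP P0 tau v <= U v.
Proof.
move=> w1 pay v /andP[v0 v1]; have [pv|vp] := leP (p_PP P0 tau) v; last first.
  by rewrite utility_PP_low//; exact: utility_RS_ge0.
rewrite utility_PP_high//.
by have := utility_RS_incr v1; rewrite (utility_RS_high w1); lra.
Qed.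

End buyer_utility.

(** * The optimal posted price *)

Section posted_price.
Context {R : realType} {P0 : probability (measurableTypeR R) R} {p0 : R -> R}.
Context (hP0 : continuous_on_unit P0 p0).
Local Notation mu := (@lebesgue_measure R).
Local Notation G := (ccdf0 P0).
Local Notation r := (revenue P0).

(* A primitive of the complementary distribution function. *)
Let A (x : R) := \int[mu]_(t in `[0, x]) G t.

Lemma is_derive_ccdf0_primitive (x : R) : 0 < x -> is_derive x 1 A (G x).
Proof.
move=> x0; have x1 : x < x + 1 by lra.
have iG : mu.-integrable `[0, x + 1] (EFin \o G).
  exact/continuous_integrable_itv/(ccdf0_continuous hP0).
have cG : {for x, continuous G} by exact: (ccdf0_continuous hP0).
have [dA <-] := continuous_FTC1_closed x1 iG x0 cG.
by rewrite derive1E; exact: DeriveDef.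
Qed.

Lemma is_derive_affine (c d x : R) : is_derive x 1 (fun y : R => c + d * y) d.
Proof. by apply: is_derive_eq; rewrite add0r mul1r [_ *: _]mulr1. Qed.

Lemma is_derive_comp_affine (f : R -> R) (c d x df : R) : is_derive (c + d * x) 1 f df ->
  is_derive x 1 (fun y => f (c + d * y)) (df * d).
Proof. move=> h.
exact: (@is_derive1_comp _ f (fun y => c + d * y) x df d h (is_derive_affine c d x)). Qed.

Lemma ccdf0_itvoy x : P0 `]x, +oo[%classic = (G x)%:E.
Proof.
have -> : `]x, +oo[%classic = ~` `]-oo, x]%classic :> set (measurableTypeR R).
  by rewrite setCitvl.
rewrite probability_setC// /ccdf0 /cdf0 EFinB fineK// fin_num_measure//.
Qed.

(** Layer-cake formula: for 0 <= y < p, the random variable exceeds y exactly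
    when v > p + y / k, and it never exceeds p. *)
Lemma PP_obj_integral (k p : R) : 0 < k -> 0 <= p ->
  PP_obj P0 k p = \int[mu]_(y in `[0, p[) G (p + k^-1 * y).
Proof.
move=> k0 p_ge0; rewrite /PP_obj.
pose X (v : measurableTypeR R) : R := Num.min p (k * pos_part (v - p)).
have cX : continuous (X : R -> R).
  move=> x; apply: (@continuous_min _ _ (cst p) (fun v => k * pos_part (v - p))).
    exact: cst_continuous.
  apply: cvgM; first exact: cvg_cst.
  apply: (@continuous_max _ _ (fun v => v - p) (cst 0)); last exact: cst_continuous.
  by apply: cvgB; [exact: cvg_id|exact: cvg_cst].
have mX : measurable_fun [set: measurableTypeR R] X.
  exact: continuous_measurable_fun.
pose X' : {RV P0 >-> R} := mfun_Sub (mem_set mX).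
have X_ge0 v : 0 <= X' v.
  rewrite /X' /= /X le_min p_ge0 mulr_ge0//; first exact: ltW.
  by rewrite /pos_part le_max lexx orbT.
transitivity (fine 'E_P0[X']%E); first by [].
rewrite (ge0_expectation_ccdf X_ge0).
have -> : `[0%R, p[%classic = `[0%R, +oo[%classic `&` `]-oo, p[%classic.
  by apply/seteqP; split=> y /=; rewrite !in_itv/= andbT => /andP.
rewrite Rintegral_mkcondr /Rintegral; congr fine.
apply: eq_integral => y /set_mem/=; rewrite in_itv/= andbT => y0.
rewrite patchE /ccdf /distribution /pushforward; case: ifPn => /=.
  rewrite inE/= in_itv/= => yp; rewrite -ccdf0_itvoy; congr (P0 _).
  suff E v : (y < k * pos_part (v - p)) = (p + k^-1 * y < v).
    by apply/seteqP; split=> v /=; rewrite !in_itv/= !andbT lt_min yp/= E.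
  rewrite -ltrBrDl -[RHS](ltr_pM2l k0) mulVKf ?gt_eqF// /pos_part.
  by rewrite maxr_pMr ?ltW// mulr0 lt_max [y < 0]ltNge y0 orbF.
rewrite notin_setE/= in_itv/= => /negP; rewrite -leNgt => py.
rewrite (_ : _ @^-1` _ = set0) ?measure0//.
by rewrite -subset0 => v /=; rewrite in_itv/= andbT lt_min ltNge py.
Qed.

Lemma is_derive_scale (f : R -> R) (c x df : R) :
  is_derive x 1 f df -> is_derive x 1 (fun y => c * f y) (c * df).
Proof. by move=> h; exact: is_deriveZ. Qed.

(* Up to the factor k, the objective for the price p, where t = 1 + 1/k. *)
Let gain (t p : R) := A (t * p) - A p.

Lemma PP_objE k p : 0 < k -> 0 < p -> PP_obj P0 k p = k * gain (1 + k^-1) p.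
Proof.
move=> k0 p_gt0.
have cG x : {for x, continuous (fun y => G (p + k^-1 * y))}.
  apply: (@continuous_comp _ _ _ (fun y => p + k^-1 * y) G).
    by apply: cvgD; [exact: cvg_cst|apply: cvgM; [exact: cvg_cst|exact: cvg_id]].
  exact: (ccdf0_continuous hP0).
have iG c d : mu.-integrable [set` Interval (BSide c 0) (BSide d p)]
    (EFin \o (fun y => G (p + k^-1 * y))).
  by apply: integrable_in_continuous_itv => x _; exact: cG.
rewrite PP_obj_integral//; last exact: ltW.
rewrite Rintegral_itv_bndo_bndc// -Rintegral_itv_obnd_cbnd//.
have dF x : 0 <= x <= p ->
    is_derive x 1 (fun y => k * A (p + k^-1 * y)) (G (p + k^-1 * x)).
  move=> /andP[x0 _].
  rewrite -[X in is_derive _ _ _ X](mulKf (x := k)) ?gt_eqF//.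
  rewrite [X in is_derive _ _ _ X]mulrCA; apply: is_derive_scale.
  rewrite mulrC; apply: is_derive_comp_affine; apply: is_derive_ccdf0_primitive.
  by rewrite ltr_wpDr// mulr_ge0// invr_ge0 ltW.
rewrite (Rintegral_FTC2 p_gt0 _ dF)//.
by rewrite mulr0 addr0 -mulrBr /gain mulrDl mul1r.
Qed.

Lemma PP_obj0 k : 0 < k -> PP_obj P0 k 0 = 0.
Proof.
move=> k0; rewrite /PP_obj (_ : (fun _ => _) = cst 0) ?expectation_cst//.
apply/funext => v; apply/min_idPl.
by rewrite mulr_ge0 ?(ltW k0)// /pos_part le_max lexx orbT.
Qed.


Lemma gainE t p : 0 < p -> 1 < t -> gain t p = \int[mu]_(x in `]p, t * p]) G x.
Proof.
move=> p_gt0 t1.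
have dA x : p <= x <= t * p -> is_derive x 1 A (G x).
  move=> /andP[px _]; apply: is_derive_ccdf0_primitive; exact: lt_le_trans px.
by rewrite (Rintegral_FTC2 _ _ dA)// ?ltr_pMl// => x _; exact: (ccdf0_continuous hP0).
Qed.

Lemma is_derive_gain (t p : R) : 0 < t -> 0 < p ->
  is_derive p 1 (gain t) (t * G (t * p) - G p).
Proof.
move=> t0 p_gt0; apply: is_deriveB; last exact: is_derive_ccdf0_primitive.
have : is_derive p 1 (fun y => A (0 + t * y)) (G (0 + t * p) * t).
  apply: is_derive_comp_affine; apply: is_derive_ccdf0_primitive.
  by rewrite add0r mulr_gt0.
rewrite add0r mulrC (_ : (fun _ => _) = (fun y => A (t * y)))//.
by apply/funext => y; rewrite add0r.
Qed.

(** The derivative of the gain at c is t G(t c) - G(c), which is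
    (r(t c) - r(c)) / c. *)
Lemma gain_MVT t p q : 0 < t -> 0 < p -> p < q ->
  exists2 c, p < c < q & gain t q - gain t p = (r (t * c) - r c) / c * (q - p).
Proof.
move=> t0 p_gt0 pq.
have dg x : x \in `]p, q[ -> is_derive x 1 (gain t) (t * G (t * x) - G x).
  rewrite in_itv/= => /andP[px _]; apply: is_derive_gain => //.
  exact: lt_trans px.
have cg : {within `[p, q], continuous (gain t)}.
  apply: continuous_in_subspaceT => x /set_mem/=; rewrite in_itv/= => /andP[px _].
  have [dgx _] := is_derive_gain t0 (lt_le_trans p_gt0 px).
  by apply: differentiable_continuous; exact/derivable1_diffP.
have [c + ->] := MVT pq dg cg; rewrite in_itv/= => /[dup] cpq /andP[pc _].
exists c => //; congr (_ * _); have c0 : 0 < c by exact: lt_trans pc.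
by rewrite /revenue; field; rewrite gt_eqF.
Qed.

Section pair.
Context {xs u t : R}.
Context (r_unimodal : unimodal P0 xs) (uw : level_pair P0 xs u (t * u)).

Lemma level_pair_ratio_gt1 : 1 < t.
Proof.
have [u0 uxs xsw _ _] := uw.
by rewrite -(ltr_pM2r u0) mul1r; exact: lt_trans xsw.
Qed.

(** Below u, the point t c lies either below u, on the increasing branch, or
    between u and t u, where the revenue is at least r(u). *)
Lemma revenue_lt_scaled c : 0 < c -> c < u -> r c < r (t * c).
Proof.
have t1 := level_pair_ratio_gt1; have t0 : 0 < t by lra.
have [u0 uxs xsw w1 ruw] := uw => c0 cu.
have ctc : c < t * c by rewrite ltr_pMl.
have tctu : t * c < t * u by rewrite ltr_pM2l.
have [tcu|utc] := ltP (t * c) u.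
  by have [_ inc _] := r_unimodal; apply: inc => //; [exact: ltW|lra].
apply: (@lt_le_trans _ _ (r u)).
  by apply: (level_pair_gt_left r_unimodal uw); rewrite ltW.
move: utc; rewrite le_eqVlt => /predU1P[<-//|utc].
by apply/ltW/(level_pair_lt_mid r_unimodal uw); rewrite utc.
Qed.

(** Above u, the point t c lies beyond t u: the revenue there is below r(u),
    which is less than r(c), if c < t u, and otherwise both points are on the
    decreasing branch. *)
Lemma revenue_gt_scaled c : u < c -> c < 1 -> r (t * c) < r c.
Proof.
have t1 := level_pair_ratio_gt1; have t0 : 0 < t by lra.
have [u0 uxs xsw w1 ruw] := uw => uc c1.
have c0 : 0 < c by exact: lt_trans uc.
have ctc : c < t * c by rewrite ltr_pMl.
have tutc : t * u < t * c by rewrite ltr_pM2l.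
have [tc1|tc1] := leP 1 (t * c).
  by rewrite (revenue_eq0 hP0 tc1); exact: (revenue_gt0 hP0 r_unimodal).
have [cw|wc] := ltP c (t * u).
  apply: (@lt_trans _ _ (r u)); last first.
    by apply: (level_pair_lt_mid r_unimodal uw); rewrite uc.
  by apply: (level_pair_gt_right r_unimodal uw); rewrite tutc ltW.
by have [_ _ dec] := r_unimodal; apply: dec => //; [lra|exact: ltW].
Qed.

Lemma gain_lt p : 0 < p -> p <= 1 -> p != u -> gain t p < gain t u.
Proof.
have t1 := level_pair_ratio_gt1; have t0 : 0 < t by lra.
have [u0 uxs xsw w1 ruw] := uw => p_gt0 p1 pu.
have [ltpu|ltup|eqpu] := ltgtP p u; last by rewrite eqpu eqxx in pu.
- have [c /andP[pc cu] E] := gain_MVT t0 p_gt0 ltpu.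
  have c0 : 0 < c by exact: lt_trans pc.
  rewrite -subr_gt0 E mulr_gt0 ?subr_gt0// divr_gt0// subr_gt0.
  exact: revenue_lt_scaled.
- have [c /andP[uc cp] E] := gain_MVT t0 u0 ltup.
  have c0 : 0 < c by exact: lt_trans uc.
  rewrite -subr_lt0 E pmulr_llt0 ?subr_gt0// pmulr_llt0 ?invr_gt0// subr_lt0.
  by apply: revenue_gt_scaled => //; exact: lt_le_trans p1.
Qed.

Lemma gain_gt0 : 0 < gain t u.
Proof.
have t1 := level_pair_ratio_gt1.
have [u0 uxs xsw w1 ruw] := uw.
have uw' : u < t * u by exact: lt_trans xsw.
rewrite gainE//; apply: (@Rintegral_gt0 _ _ _ u (t * u)) => //.
- exact/continuous_integrable_itv/(ccdf0_continuous hP0).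
- exact: subset_itv_oo_oc.
- by move=> x _; exact: ccdf0_ge0.
- move=> x /andP[ux xw]; have x0 : 0 < x by exact: lt_trans ux.
  rewrite -(pmulr_rgt0 _ x0); apply: (revenue_gt0 hP0 r_unimodal) => //.
  exact: lt_trans w1.
Qed.

Context {k : R}.
Context (k_gt0 : 0 < k) (kt : t = 1 + k^-1).

Lemma PP_obj_lt p : 0 <= p <= 1 -> p != u -> PP_obj P0 k p < PP_obj P0 k u.
Proof.
have [u0 _ _ _ _] := uw.
move=> /andP[]; rewrite (PP_objE k_gt0 u0) -kt le_eqVlt => /predU1P[<- _ _|p_gt0 p1 pu].
  by rewrite PP_obj0// mulr_gt0// gain_gt0.
by rewrite PP_objE// -kt ltr_pM2l// gain_lt.
Qed.

Lemma level_in_unit : u \in `[0, 1].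
Proof. by have [u0 uxs xsw w1 _] := uw; rewrite in_itv/=; apply/andP; split; lra. Qed.

Lemma price_PPE : price_PP P0 k = u.
Proof.
apply: xget_unique => [|p []] /=.
  split; first exact: level_in_unit.
  move=> p /=; rewrite in_itv/= => p01.
  by have [->//|/(PP_obj_lt p01)/ltW] := eqVneq p u.
rewrite in_itv/= => p01 pmax; apply/eqP; apply: contraT.
by move=> /(PP_obj_lt p01); rewrite ltNge pmax//; exact: level_in_unit.
Qed.

Lemma rho_PPE : rho_PP P0 k = k * \int[mu]_(x in `]u, t * u]) G x.
Proof.
have [u0 _ _ _ _] := uw.
rewrite -gainE//; last exact: level_pair_ratio_gt1.
rewrite kt -PP_objE// /rho_PP.
have ub : ubound [set PP_obj P0 k p | p in `[0, 1]] (PP_obj P0 k u).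
  move=> _ [p /= + <-]; rewrite in_itv/= => p01.
  by have [->//|/(PP_obj_lt p01)/ltW] := eqVneq p u.
have ex : [set PP_obj P0 k p | p in `[0, 1]] (PP_obj P0 k u).
  by exists u => //; exact: level_in_unit.
apply/eqP; rewrite eq_le ge_sup//=; last by exists (PP_obj P0 k u).
by apply: ub_le_sup => //; exists (PP_obj P0 k u).
Qed.

End pair.
End posted_price.

(** * Power distributions *)

Section power_distribution.
Context {R : realType} {P0 : probability (measurableTypeR R) R} {p0 : R -> R}.
Context (hP0 : continuous_on_unit P0 p0).
Context {alpha : R}.
Context (alpha_gt0 : 0 < alpha).
Context (cdf0_pow : forall x, 0 <= x <= 1 -> cdf0 P0 x = x `^ alpha).
Local Notation mu := (@lebesgue_measure R).
Local Notation G := (ccdf0 P0).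
Local Notation r := (revenue P0).

Let marginal (x : R) := 1 - (alpha + 1) * x `^ alpha.

Lemma is_derive_revenue_pow (x : R) : 0 < x < 1 -> is_derive x 1 r (marginal x).
Proof.
move=> /andP[x0 x1].
have dpow := is_derive1_powR alpha x0.
have : is_derive x 1 (fun y : R => y - y * y `^ alpha) (marginal x).
  apply: is_derive_eq; rewrite /GRing.scale/= mulr1 mulrCA mulr_powRB1 ?ltW//.
  by rewrite /marginal mulrDl mul1r.
apply: near_eq_is_derive; near=> y.
have y0 : 0 < y by near: y; exact: lt_nbhsr.
have y1 : y < 1 by near: y; exact: lt_nbhsl.
by rewrite /revenue /ccdf0 cdf0_pow ?ltW// mulrBr mulr1.
Unshelve. all: by end_near. Qed.

Let xs : R := (alpha + 1)^-1 `^ alpha^-1.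

Let a1 : 0 < alpha + 1. Proof. exact: addr_gt0. Qed.

Lemma mode_pow : (alpha + 1) * xs `^ alpha = 1.
Proof.
by rewrite /xs -powRrM mulVf ?gt_eqF// powRr1 ?invr_ge0 ?ltW// mulfV// gt_eqF.
Qed.

Lemma mode_pow_itv : 0 < xs < 1.
Proof.
rewrite /xs powR_gt0 ?invr_gt0//= -[ltRHS]/((fun=> 1) alpha^-1) -powR1.
apply: gt0_ltr_powR; rewrite ?invr_gt0// ?nnegrE ?invr_ge0 ?ler01 ?ltW//.
by rewrite invf_lt1// ltrDr.
Qed.

Lemma revenue_pow_MVT x y : 0 <= x -> x < y -> y <= 1 ->
  exists2 c, x < c < y & r y - r x = marginal c * (y - x).
Proof.
move=> x0 xy y1.
have dr c : c \in `]x, y[ -> is_derive c 1 r (marginal c).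
  rewrite in_itv/= => /andP[xc cy]; apply: is_derive_revenue_pow.
  by rewrite (le_lt_trans x0 xc) (lt_le_trans cy y1).
have cr : {within `[x, y], continuous r}.
  by apply: continuous_subspaceT; exact: (revenue_continuous hP0).
by have [c + ->] := MVT xy dr cr; rewrite in_itv/=; exists c.
Qed.

Lemma pow_lt x y : 0 <= x -> x < y -> x `^ alpha < y `^ alpha.
Proof.
by move=> x0 xy; apply: gt0_ltr_powR; rewrite ?nnegrE// ltW// (le_lt_trans x0).
Qed.

(** The derivative 1 - (alpha + 1) x^alpha changes sign once, at the mode.
    Going through the virtual value would not do: the density agrees with
    alpha x^(alpha - 1) only almost everywhere, so it need not be regular. *)
Lemma power_unimodal : unimodal P0 xs.
Proof.
have /andP[xs0 xs1] := mode_pow_itv.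
split=> [|x y x0 xy yxs|x y xsx xy y1]; first exact: mode_pow_itv.
- have y1 : y <= 1 by exact: le_trans (ltW xs1).
  have [c /andP[xc cy] E] := revenue_pow_MVT x0 xy y1.
  rewrite -subr_gt0 E mulr_gt0 ?subr_gt0// -[ltRHS]mode_pow ltr_pM2l//.
  by apply: pow_lt; [exact: le_trans x0 (ltW xc)|exact: lt_le_trans cy yxs].
- have x0 : 0 <= x by exact: le_trans (ltW xs0) xsx.
  have [c /andP[xc cy] E] := revenue_pow_MVT x0 xy y1.
  rewrite -subr_lt0 E pmulr_llt0 ?subr_gt0// subr_lt0 -[ltLHS]mode_pow ltr_pM2l//.
  by apply: pow_lt; [exact: ltW|exact: le_lt_trans xsx xc].
Qed.

Lemma Pi0_pow : Pi0 P0 = alpha / (alpha + 1) * xs.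
Proof.
have /andP[xs0 xs1] := mode_pow_itv.
rewrite (Pi0E power_unimodal) /revenue /ccdf0 cdf0_pow ?ltW//.
have -> : xs `^ alpha = (alpha + 1)^-1.
  by rewrite -[RHS]mulr1 -[X in _ = _ * X]mode_pow mulKf// gt_eqF.
by field; rewrite gt_eqF.
Qed.

(** The function (alpha x + r(x)) / (alpha + 1) has derivative 1 - x^alpha, and
    the contributions of r cancel on a pair of equal revenues. *)
Lemma level_pair_integral_pow u w : level_pair P0 xs u w ->
  \int[mu]_(x in `]u, w]) G x = alpha / (alpha + 1) * (w - u).
Proof.
move=> [u0 uxs xsw w1 ruw].
pose B x := (alpha + 1)^-1 * (alpha * x + r x).
have dB x : u <= x <= w -> is_derive x 1 B (G x).
  move=> /andP[ux xw]; have x0 : 0 < x by lra.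
  have x1 : x < 1 by lra.
  have dr : is_derive x 1 r (marginal x) by apply: is_derive_revenue_pow; rewrite x0.
  apply: is_derive_eq; rewrite /GRing.scale/= mulr1 /marginal /ccdf0 cdf0_pow ?ltW//.
  by field; rewrite gt_eqF.
rewrite (Rintegral_FTC2 _ _ dB); last 2 first.
- by lra.
- by move=> x _; exact: (ccdf0_continuous hP0).
by rewrite /B ruw; field; rewrite gt_eqF.
Qed.

(** The optimal value is alpha / (alpha + 1) times the optimal price u, so u is
    determined by tau.  It lies below the mode because the maximal revenue is
    alpha / (alpha + 1) times the mode; its partner w then gives k through
    1 + 1/k = w / u. *)
Lemma rho_PP_pow_surjective tau : 0 < tau < Pi0 P0 ->
  exists2 k, 0 < k & rho_PP P0 k = tau.
Proof.
have /andP[xs0 xs1] := mode_pow_itv.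
have uni := power_unimodal.
rewrite Pi0_pow => /andP[tau0 tau_lt].
pose u := (alpha + 1) / alpha * tau.
have tauE : tau = alpha / (alpha + 1) * u.
  by rewrite /u; field; rewrite !gt_eqF.
have aa : 0 < alpha / (alpha + 1) by rewrite divr_gt0.
have u0 : 0 < u by rewrite mulr_gt0// divr_gt0.
have uxs : u < xs by move: tau_lt; rewrite tauE ltr_pM2l.
have [_ inc dec] := uni.
have ru : r u < r xs by apply: inc => //; exact: ltW.
have ru0 : 0 < r u by apply: (revenue_gt0 hP0 uni); lra.
have cr : {within `[xs, 1], continuous r}.
  by apply: continuous_subspaceT; exact: (revenue_continuous hP0).
have [|w] := IVT (ltW xs1) cr (v := r u).
  by rewrite (revenue_eq0 hP0 (lexx 1)) ge_min le_max (ltW ru) (ltW ru0) orbT.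
rewrite in_itv/= => /andP[xsw w1] rw.
have uw : level_pair P0 xs u w.
  split=> //; rewrite lt_neqAle ?xsw ?w1 andbT; apply/eqP => E.
    by move: ru; rewrite -rw -E ltxx.
  by move: ru0; rewrite -rw E (revenue_eq0 hP0 (lexx 1)) ltxx.
have uw_lt : u < w by lra.
pose k := u / (w - u).
have k0 : 0 < k by rewrite divr_gt0 ?subr_gt0.
have tu : (1 + k^-1) * u = w by rewrite /k; field; rewrite !gt_eqF ?subr_gt0.
exists k => //; rewrite -tu in uw.
rewrite (rho_PPE hP0 uni uw k0 erefl) (level_pair_integral_pow uw) tu tauE /k.
by field; rewrite !gt_eqF ?subr_gt0.
Qed.

Lemma p_PP_pow tau : 0 < tau < Pi0 P0 -> p_PP P0 tau = (alpha + 1) / alpha * tau.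
Proof.
move=> /rho_PP_pow_surjective[k0 k00 rk0].
have [k_gt0 rk] : 0 < k_PP P0 tau /\ rho_PP P0 (k_PP P0 tau) = tau.
  by apply: (@xgetPex _ 0 [set k | 0 < k /\ rho_PP P0 k = tau]); exists k0.
have uni := power_unimodal.
have t1 : 1 < 1 + (k_PP P0 tau)^-1 by rewrite ltrDl invr_gt0.
have [u uw] := level_pair_ratio hP0 uni t1.
rewrite /p_PP (price_PPE hP0 uni uw k_gt0 erefl).
rewrite -[in RHS]rk (rho_PPE hP0 uni uw k_gt0 erefl) (level_pair_integral_pow uw).
by field; rewrite !gt_eqF.
Qed.

Lemma payment_RS_pow tau : 0 < tau < Pi0 P0 ->
  k_RS P0 tau * (w_RS P0 tau - u_RS P0 tau) = (alpha + 1) / alpha * tau.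
Proof.
move=> /(RS_mechanism_parameters hP0 power_unimodal)[k_gt0 uw _].
rewrite (level_pair_integral_pow uw) => E; rewrite -[in RHS]E.
by field; rewrite !gt_eqF.
Qed.

End power_distribution.

(** * Comparison of the two mechanisms *)

Theorem theorem3 (R : realType) (P0 : probability (measurableTypeR R) R)
    (p0 : R -> R) (tau : R)
    (hP0 : continuous_on_unit P0 p0) (htau : 0 < tau < Pi0 P0) :
  (regular P0 p0 ->
     exists2 vbar : R, p_PP P0 tau <= vbar <= 1 &
       forall v : R, 0 <= v <= 1 ->
         (q_PP P0 tau v * v - m_PP P0 tau v <= q_RS P0 tau v * v - m_RS P0 tau v
          <-> v <= vbar))
  /\
  (forall alpha : R, 1 <= alpha ->
     (forall x : R, 0 <= x <= 1 -> cdf0 P0 x = x `^ alpha) ->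
     forall v : R, 0 <= v <= 1 ->
       q_PP P0 tau v * v - m_PP P0 tau v <= q_RS P0 tau v * v - m_RS P0 tau v).
Proof.
split=> [/(regular_unimodal hP0)[xs r_unimodal]|alpha alpha1 cdf0_pow].
  have [k0 [u0 uxs xsw _ _] kuw _] := RS_mechanism_parameters hP0 r_unimodal htau.
  exact: utility_threshold k0 u0 (lt_trans uxs xsw) kuw.
have alpha0 : 0 < alpha by exact: lt_le_trans alpha1.
have uni := power_unimodal hP0 alpha0 cdf0_pow.
have [k0 [u0 uxs xsw w1 _] kuw _] := RS_mechanism_parameters hP0 uni htau.
apply: (utility_RS_dominates k0 u0 (lt_trans uxs xsw) kuw (ltW w1)).
by rewrite (payment_RS_pow hP0 alpha0) ?(p_PP_pow hP0 alpha0).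
Qed.
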